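(* Let $F$ be an algebraically closed field of characteristic $0$, $n\ge1$, $V=F^{n+1}$, and let $l>n+1$. Let $\mathbf r=(r_1,\dots,r_l)$ be integers and $k\ge 0$ an integer. Put $k'=r_1+\cdots+r_{n+1}-n-1-k$, $r_i'=r_1+\cdots+r_{n+1}-n-1+r_i-2k$ for $n+2\le i\le l$, and $\mathbf r'=(r_1,\dots,r_{n+1},r'_{n+2},\dots,r'_l)$. Then $$h(\mathbf r;k)=h(\mathbf r';k').$$
   Context: Let $S=S(V)=\bigoplus_kS^k$ be the symmetric algebra (polynomial ring) of $V$, with $S^j=0$ for $j<0$. For points $p_1,\dots,p_l\in V\setminus\{0\}$ and integers $r_i$, $k$, put $h(\mathbf p;\mathbf r;k)=\dim_F\bigl(S^k/\sum_{i}S^{k-r_i}p_i^{r_i}\bigr)$, and let $h(\mathbf r;k)$ be the minimum of $h(\mathbf p;\mathbf r;k)$ over all choices of $\mathbf p$ (i.e. its value for $l$ sufficiently generic points of $\mathbb P(V)=\mathbb P^n$). Conventions: $h(\mathbf r;k)=0$ if $k<0$ or if some $r_i<0$. *)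

(* Defs.v *)
From HB Require Import structures.
From mathcomp Require Import all_boot all_order all_algebra.
From mathcomp Require Import mpoly.
From Stdlib Require Import ClassicalDescription.
Set Implicit Arguments. Unset Strict Implicit. Unset Printing Implicit Defensive.
Import Order.TTheory GRing.Theory Num.Theory.
Local Open Scope ring_scope.

Definition natmin (P : nat -> Prop) : nat :=
  match excluded_middle_informative (exists m, P m) with
  | left ex => ex_minn (P := fun m => if excluded_middle_informative (P m)
                                       then true else false)
                 (let: ex_intro m Pm := ex in
                  ex_intro _ m (match excluded_middle_informative (P m) as b
                      return (if b then true else false) with
                   | left _ => erefl | right nP => False_ind _ (nP Pm) end))
  | right _ => 0%N
  end.

(* S = S(V) = F[x_0,...,x_n], V = F^{n+1}; S^k = dhomog n.+1 F k. *)
Section HDef.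
Variables (F : fieldType) (n : nat).

Definition linform (v : 'rV[F]_(n.+1)) : {mpoly F[n.+1]} :=
  \sum_(j < n.+1) v 0 j *: 'X_j.

Definition powspace (k r : nat) (v : 'rV[F]_(n.+1)) : {vspace dhomog n.+1 F k} :=
  if (r <= k)%N then
    <<[seq @indhomog n.+1 F k (val q * linform v ^+ r)
          | q <- vbasis (fullv : {vspace dhomog n.+1 F (k - r)})]>>%VS
  else 0%VS.

(* h(p; r; k) = dim_F (S^k / sum_i S^{k-r_i} p_i^{r_i})  for r_i, k >= 0 *)
Definition hp (l : nat) (p : 'I_l -> 'rV[F]_(n.+1)) (r : 'I_l -> nat) (k : nat) : nat :=
  (\dim (fullv : {vspace dhomog n.+1 F k})
   - \dim (\sum_(i < l) powspace k (r i) (p i)))%N.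

Definition h (l : nat) (r : 'I_l -> int) (k : int) : nat :=
  if (k < 0) || [exists i, r i < 0] then 0%N
  else natmin (fun m => exists p : 'I_l -> 'rV[F]_(n.+1),
                 (forall i, p i != 0) /\ hp p (fun i => `|r i|%N) `|k|%N = m).
End HDef.

(* Main.v *)
Require Import Defs.
From HB Require Import structures.
From mathcomp Require Import all_boot all_order all_algebra.
From mathcomp Require Import mpoly.
From mathcomp Require Import ring zify.
From Stdlib Require Import FunctionalExtensionality.
From Stdlib Require ClassicalDescription.
Set Implicit Arguments. Unset Strict Implicit. Unset Printing Implicit Defensive.
Import Order.TTheory GRing.Theory Num.Theory.
Local Open Scope ring_scope.

(** By semicontinuity of the rank along a line, and by a linear change of
coordinates, the minimum [h] is attained when [p_1, ..., p_(n+1)] is the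
standard basis and the other points have nonzero coordinates. Send a form of
degree [k] to the function [a |-> a! f_a] on its exponents. Dividing by
[x_i^(r_i)] for [i <= n+1] restricts these functions to the box [B] of
exponents [a] with [|a| = k] and [a_i < r_i]. By the multinomial theorem,
the multiples of the [r]-th power of the linear form [p] become the functions
[a |-> p^a q(a)] with [q] a polynomial of degree at most [k - r]. Hence [h] is
the codimension, in the functions on [B], of a sum of spaces
[{p_j^a q(a) : deg q <= k - r_j}]. The Cremona reflection
[a_i |-> r_i - 1 - a_i], together with [p_j |-> p_j^-1], carries this data for
[(r, k)] to the data for [(r', k')], since [k' - r'_j = k - r_j]. *)

(** * Multiples of a power of a linear form *)

Lemma linear_lfun (F : fieldType) (U V : vectType F) (f : U -> V) :
  linear f -> exists g : 'Hom(U, V), g =1 f.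
Proof.
move=> lin_f.
pose f' : {linear U -> V} :=
  HB.pack_for {linear U -> V} f (GRing.isLinear.Build F U V _ f lin_f).
by exists (linfun f') => u; rewrite lfunE.
Qed.

Section Powspace.
Variables (F : fieldType) (n : nat).
Implicit Types (v : 'rV[F]_n.+1) (q : {mpoly F[n.+1]}) (k r : nat).

Lemma linform_homog v : linform v \is 1.-homog.
Proof.
apply: rpred_sum => j _; apply: rpredZ.
by rewrite dhomogX /= mdeg1.
Qed.

Lemma val_indhomog k q : q \is k.-homog -> val (@indhomog n.+1 F k q) = q.
Proof. exact: insubdK. Qed.

Lemma mul_linform_homog k r v q : (r <= k)%N ->
  q \is (k - r).-homog -> q * linform v ^+ r \is k.-homog.
Proof.
move=> le_rk hq; rewrite -(subnK le_rk); apply: dhomogM => //.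
by rewrite -[r in X in _ \is X]mul1n; apply: dhomogMn (linform_homog v).
Qed.

(** The spanning list of [powspace] is the image of a basis under multiplication by
    [linform v ^+ r], so its span is the image of that linear map. *)
Lemma powspace_lfun k r v : (r <= k)%N ->
  exists2 g : 'Hom(dhomog n.+1 F (k - r), dhomog n.+1 F k),
    (forall q : dhomog n.+1 F (k - r), val (g q) = val q * linform v ^+ r)
    & powspace k r v = limg g.
Proof.
move=> le_rk; pose f (q : dhomog n.+1 F (k - r)) :=
  @indhomog n.+1 F k (val q * linform v ^+ r).
have fE x : val (f x) = val x * linform v ^+ r.
  by rewrite val_indhomog ?mul_linform_homog ?dhomog_is_dhomog.
have [|g gE] := @linear_lfun F _ _ f.
  move=> c p q; apply: val_inj.
  by rewrite linearP /= !fE /= mulrDl scalerAl.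
exists g => [q|]; first by rewrite gE fE.
rewrite /powspace le_rk -[in RHS](span_basis (vbasisP fullv)) limg_span.
by rewrite -(eq_map gE).
Qed.

Lemma mem_powspace k r v q : (r <= k)%N -> q \is (k - r).-homog ->
  @indhomog n.+1 F k (q * linform v ^+ r) \in powspace k r v.
Proof.
move=> le_rk hq; have [g gE ->] := powspace_lfun v le_rk.
have -> : @indhomog n.+1 F k (q * linform v ^+ r) = g (DHomog hq).
  by apply: val_inj; rewrite gE val_indhomog // mul_linform_homog.
exact: memv_img (memvf _).
Qed.

Lemma powspaceP k r v f : f \in powspace k r v ->
  exists2 q, q \is (k - r).-homog & val f = q * linform v ^+ r.
Proof.
have [le_rk|lt_kr] := leqP r k; last first.
  rewrite /powspace leqNgt lt_kr memv0 => /eqP ->.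
  by exists 0; rewrite ?rpred0 // mul0r.
have [g gE ->] := powspace_lfun v le_rk.
by case/memv_imgP=> q _ ->; exists (val q); rewrite ?gE ?dhomog_is_dhomog.
Qed.

Lemma mcoeffMXm q (b m : 'X_{1..n.+1}) :
  (q * 'X_[b])@_m = if (b <= m)%MM then q@_(m - b) else 0.
Proof.
case: ifPn => [le_bm|nle].
  rewrite -{1}(submK le_bm) addmC mcoeffMX //.
apply: memN_msupp_eq0; rewrite (perm_mem (msuppMX _ _)).
apply: contra nle => /mapP [m' _ ->]; exact: lem_addr.
Qed.

Definition mfact (m : 'X_{1..n.+1}) : nat := (\prod_i (m i)`!)%N.
Definition rowpow v (m : 'X_{1..n.+1}) : F := \prod_i v 0 i ^+ m i.

Lemma rowpowD v m1 m2 : rowpow v (m1 + m2)%MM = rowpow v m1 * rowpow v m2.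
Proof. by rewrite -big_split; apply: eq_bigr => i _; rewrite mnmDE exprD. Qed.

Lemma rowpowU v i : rowpow v U_(i)%MM = v 0 i.
Proof.
rewrite /rowpow (bigD1 i) //= mnm1E eqxx expr1 big1 ?mulr1 // => j ne_ji.
by rewrite mnm1E eq_sym (negPf ne_ji) expr0.
Qed.

Lemma rowpow_neq0 v m : (forall i, v 0 i != 0) -> rowpow v m != 0.
Proof. by move=> nzv; apply/prodf_neq0 => i _; apply: expf_neq0. Qed.

Lemma mfactB (m b : 'X_{1..n.+1}) : (b <= m)%MM ->
  mfact m = ((\prod_i (m i ^_ b i)) * mfact (m - b)%MM)%N.
Proof.
move=> /mnm_lepP le_bm; rewrite -big_split /=; apply: eq_bigr => i _.
by rewrite mnmBE ffact_fact.
Qed.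

Lemma prod_ffactU (m : 'X_{1..n.+1}) i : (\prod_j (m j ^_ U_(i)%MM j) = m i)%N.
Proof.
rewrite (bigD1 i) //= mnm1E eqxx ffactn1 big1 ?muln1 // => j ne_ji.
by rewrite mnm1E eq_sym (negPf ne_ji).
Qed.

(* The multinomial theorem, in a form free of divisions. *)
Lemma mfact_linformX v r (m : 'X_{1..n.+1}) : mdeg m = r ->
  (mfact m)%:R * (linform v ^+ r)@_m = (r`!)%:R * rowpow v m.
Proof.
elim: r m => [|r IHr] m degm.
  move/eqP: degm; rewrite mdeg_eq0 => /eqP ->.
  rewrite expr0 mcoeff1 eqxx mulr1 fact0 mul1r /mfact /rowpow.
  by rewrite !big1 // => i _; rewrite mnm0E.
rewrite exprSr {2}/linform mulr_sumr raddf_sum mulr_sumr /=.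
(* The index [i] contributes [m_i r! v^m], and the [m_i] add up to [r + 1]. *)
transitivity (\sum_i (m i)%:R * ((r`!)%:R * rowpow v m) : F); last first.
  by rewrite -mulr_suml -natr_sum -mdegE degm factS natrM mulrA.
apply: eq_bigr => i _; rewrite -scalerAr mcoeffZ mcoeffMXm.
have [/eqP mi0|mi_gt0] := boolP (m i == 0)%N.
  rewrite mi0 mul0r ifF ?mulr0 //; apply/negP => /mnm_lepP /(_ i).
  by rewrite mnm1E eqxx mi0.
have le_im : (U_(i) <= m)%MM by rewrite lep1mP.
rewrite le_im (mfactB le_im) prod_ffactU natrM.
have degB : mdeg (m - U_(i))%MM = r.
  by move: degm; rewrite -{1}(submK le_im) mdegD mdeg1 addn1 => -[].
have E := IHr _ degB.
have -> : rowpow v m = rowpow v (m - U_(i))%MM * v 0 i.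
  by rewrite -rowpowU -rowpowD submK.
transitivity ((m i)%:R * v 0 i *
  ((mfact (m - U_(i))%MM)%:R * (linform v ^+ r)@_(m - U_(i))%MM)); first by ring.
by rewrite E; ring.
Qed.

End Powspace.

(** * Polynomial functions on lattice points *)

Section Lattice.
Variables (F : fieldType) (n R : nat).
Hypothesis charF0 : [pchar F] =i pred0.

Notation T := {ffun 'I_n.+1 -> 'I_R.+1}.
Notation V := {ffun T -> F^o}.
Implicit Types (f : V) (b : pred T) (v : 'rV[F]_n.+1) (a : T) (m : 'X_{1..n.+1}).

Lemma natf_eq0 (N : nat) : ((N%:R : F) == 0) = (N == 0)%N.
Proof. by have /pcharf0P := charF0. Qed.

Lemma scale_regE (c x : F) : c *: (x : F^o) = c * x. Proof. by []. Qed.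

Definition mulfun (u : T -> F) (f : V) : V := [ffun a => u a * f a].

Lemma mulfun_is_linear u : linear (mulfun u).
Proof.
move=> c f g; apply/ffunP => a; rewrite !ffunE mulrDr.
by congr (_ + _); apply: mulrCA.
Qed.
HB.instance Definition _ (u : T -> F) :=
  GRing.isLinear.Build F V V _ (mulfun u) (mulfun_is_linear u).

Definition lmulfun u : 'End(V) := linfun (mulfun u).

Lemma lmulfunE u f : lmulfun u f = mulfun u f.
Proof. by rewrite lfunE. Qed.

(** Exponents range over the finite cube [[0, R]^(n+1)], so that functions on them form a
    finite-dimensional space; [R >= k] lets the cube hold every exponent of degree [k]. *)
Definition expo a : 'X_{1..n.+1} := [multinom (a i : nat) | i < n.+1].

Lemma expo_inj : injective expo.
Proof.
by move=> a a' /mnmP E; apply/ffunP => i; apply: val_inj; have := E i; rewrite !mnmE.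
Qed.

Definition monfun b v : V := [ffun a => (b a)%:R * rowpow v (expo a)].

(* The functions a |-> v^a q(a) on b, for q a polynomial of degree at most d. *)
Fixpoint polyfun b v d : {vspace V} :=
  if d is d'.+1 then
    (polyfun b v d' +
     \sum_i lmulfun (fun a => (a i)%:R) @: polyfun b v d')%VS
  else <[ monfun b v ]>%VS.

Lemma polyfunS b v d : (polyfun b v d <= polyfun b v d.+1)%VS.
Proof. exact: addvSl. Qed.

Lemma polyfun_mono b v d e : (d <= e)%N -> (polyfun b v d <= polyfun b v e)%VS.
Proof.
move=> /subnK <-; elim: (e - d)%N => [|c IHc] //.
exact: subv_trans IHc (polyfunS _ _ _).
Qed.

Lemma polyfun_mulcoord b v d i f : f \in polyfun b v d ->
  mulfun (fun a => (a i)%:R) f \in polyfun b v d.+1.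
Proof.
move=> Wf; apply: subvP (addvSr _ _) _ _; apply: subvP (sumv_sup i _ (subvv _)) _ _ => //.
by rewrite -lmulfunE memv_img.
Qed.

Lemma polyfun_sub b v d (U : {vspace V}) :
  (forall f, f \in polyfun b v d -> f \in U) ->
  (forall f i, f \in polyfun b v d -> mulfun (fun a => (a i)%:R) f \in U) ->
  (polyfun b v d.+1 <= U)%VS.
Proof.
move=> sub1 sub2; rewrite subv_add; apply/andP; split; first exact/subvP.
apply/subv_sumP => i _; apply/subvP => _ /memv_imgP [f Wf ->].
by rewrite lmulfunE sub2.
Qed.

Definition supported b : {vspace V} := limg (lmulfun (fun a => (b a)%:R)).

Lemma supportedP b f :
  reflect (forall a, ~~ b a -> f a = 0) (f \in supported b).
Proof.
apply: (iffP memv_imgP) => [[g _ ->] a /negPf ba|supp].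
  by rewrite lmulfunE ffunE ba mul0r.
exists f; rewrite ?memvf // lmulfunE; apply/ffunP => a; rewrite ffunE.
by have [_|/supp ->] := boolP (b a); rewrite ?mul1r // mulr0.
Qed.

Lemma polyfun_supported b v d : (polyfun b v d <= supported b)%VS.
Proof.
elim: d => [|d IHd].
  apply/subvP => _ /vlineP [c ->]; apply/supportedP => a /negPf ba.
  by rewrite !ffunE ba mul0r scaler0.
apply: polyfun_sub => [|f i] => [|/(subvP IHd) /supportedP supp]; first exact/subvP.
by apply/supportedP => a /supp fa0; rewrite ffunE fa0 mulr0.
Qed.

Definition delta a : V := [ffun x => (x == a)%:R].

Lemma supported_sub b (U : {vspace V}) :
  (forall a, b a -> delta a \in U) -> (supported b <= U)%VS.
Proof.
move=> Ub; apply/subvP => f /supportedP supp.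
have -> : f = \sum_a f a *: delta a.
  apply/ffunP => a; rewrite sum_ffunE (bigD1 a) //= big1 ?addr0 => [|x ne_xa].
    by rewrite !ffunE eqxx scale_regE mulr1.
  by rewrite !ffunE eq_sym (negPf ne_xa) scaler0.
apply: rpred_sum => a _; have [/Ub|/supp ->] := boolP (b a); first exact: rpredZ.
by rewrite scale0r rpred0.
Qed.

(* Falling factorials: a basis of the polynomial functions adapted to the
   products X^m * linform v ^+ r. *)
Definition fallfun b v m : V :=
  [ffun a => (b a)%:R * rowpow v (expo a) * (\prod_i (expo a i ^_ m i))%:R].

Lemma fallfunU b v m i : fallfun b v (m + U_(i))%MM =
  mulfun (fun a => (a i)%:R) (fallfun b v m) - (m i)%:R *: fallfun b v m.
Proof.
apply/ffunP => a; rewrite !ffunE.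
have -> : (\prod_j (expo a j ^_ (m + U_(i))%MM j) =
           \prod_j (expo a j ^_ m j) * (a i - m i))%N.
  rewrite !(bigD1 (P := xpredT) i) //= mnmDE mnm1E eqxx addn1 ffactnSr mnmE.
  rewrite mulnAC; congr (_ * _ * _)%N; apply: eq_bigr => j ne_ji.
  by rewrite mnmDE mnm1E eq_sym (negPf ne_ji) addn0.
have [le_ma|lt_am] := leqP (m i) (a i).
  by rewrite natrM natrB //= scale_regE; ring.
(* Here [a i - m i] is truncated, which is harmless since the falling factorial is 0. *)
rewrite (bigD1 i) //= ffact_small ?mnmE // !mul0n.
by rewrite scale_regE !mulr0 subr0.
Qed.

Lemma mdegS_split m d : mdeg m = d.+1 ->
  exists i m', m = (m' + U_(i))%MM /\ mdeg m' = d.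
Proof.
move=> degm; have: mdeg m != 0%N by rewrite degm.
rewrite mdegE sum_nat_eq0 negb_forall => /existsP [i] /=.
rewrite -lt0n => mi_gt0; have le_im : (U_(i) <= m)%MM by rewrite lep1mP -lt0n.
exists i, (m - U_(i))%MM; rewrite submK //; split=> //.
by move: degm; rewrite -{1}(submK le_im) mdegD mdeg1 addn1 => -[].
Qed.

Lemma fallfun_polyfun b v m : fallfun b v m \in polyfun b v (mdeg m).
Proof.
move degm: (mdeg m) => d; elim: d m degm => [|d IHd] m degm.
  move/eqP: degm; rewrite mdeg_eq0 => /eqP ->.
  apply/vlineP; exists 1; rewrite scale1r; apply/ffunP => a; rewrite !ffunE.
  by rewrite big1 ?mulr1 // => i _; rewrite mnm0E.
have [i [m' [-> degm']]] := mdegS_split degm.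
rewrite fallfunU rpredB ?polyfun_mulcoord ?IHd //.
by apply/rpredZ/(subvP (polyfunS _ _ _))/IHd.
Qed.

(* On [|a| = k], [(k - |m|)] times the falling factorial of [m] is the sum of
   those of the [m + U_(i)], so the ones of top degree [d] suffice. *)
Lemma polyfun_fallfun k d b v (U : {vspace V}) :
    (forall a, b a -> mdeg (expo a) = k) -> (d <= k)%N ->
    (forall m, mdeg m = d -> fallfun b v m \in U) ->
  (polyfun b v d <= U)%VS.
Proof.
move=> degb; elim: d U => [|d IHd] U le_dk Ufall.
  have -> : polyfun b v 0 = <[fallfun b v 0%MM]>%VS.
    congr <[_]>%VS; apply/ffunP => a; rewrite !ffunE.
    by rewrite big1 ?mulr1 // => i _; rewrite mnm0E.
  by rewrite -memvE Ufall ?mdeg0.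
have Ufall' m : mdeg m = d -> fallfun b v m \in U.
  move=> degm; have nz : (k - d)%:R != 0 :> F by rewrite natf_eq0 subn_eq0 -ltnNge.
  suff: (k - d)%:R *: fallfun b v m \in U by rewrite rpredZeq (negPf nz).
  have -> : (k - d)%:R *: fallfun b v m = \sum_i fallfun b v (m + U_(i))%MM.
    under eq_bigr do rewrite fallfunU.
    rewrite big_split /= sumrN -scaler_suml -natr_sum -mdegE degm.
    apply/ffunP => a; rewrite 2![in RHS]ffunE sum_ffunE.
    under eq_bigr do rewrite ffunE.
    rewrite -mulr_suml -natr_sum !ffunE.
    have [ba|_] := boolP (b a); last by rewrite !scale_regE !mul0r !mulr0 subrr.
    have -> : (\sum_i a i)%N = k.
      by rewrite -(degb _ ba) mdegE; apply: eq_bigr => i _; rewrite mnmE.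
    by rewrite natrB 1?ltnW // !scale_regE mulrBl.
  by apply: rpred_sum => i _; apply: Ufall; rewrite mdegD mdeg1 degm addn1.
apply: polyfun_sub => [|f i].
  exact/subvP/IHd/Ufall'/ltnW.
(* Multiplication by a coordinate is linear, so the induction hypothesis can be used with the
   preimage of [U]. *)
rewrite -lmulfunE memv_preim; move: f; apply/subvP; apply: IHd => [|m degm].
  exact: ltnW.
rewrite -memv_preim lmulfunE.
have -> : mulfun (fun a => (a i)%:R) (fallfun b v m) =
    fallfun b v (m + U_(i))%MM + (m i)%:R *: fallfun b v m.
  by rewrite fallfunU subrK.
apply: rpredD; last exact/rpredZ/Ufall'.
by apply: Ufall; rewrite mdegD mdeg1 degm addn1.
Qed.

(** At points of degree [k], the falling factorial whose exponent is such a point [a] vanishes away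
    from [a], so degree [k] already yields every function [delta a]. *)
Lemma polyfun_full k b v : (forall i, v 0 i != 0) ->
  (forall a, b a -> mdeg (expo a) = k) -> polyfun b v k = supported b.
Proof.
move=> nzv degb; apply/eqP; rewrite eqEsubv polyfun_supported.
apply: supported_sub => a ba.
have := fallfun_polyfun b v (expo a); rewrite degb //.
have -> : fallfun b v (expo a) =
    (rowpow v (expo a) * (mfact (expo a))%:R) *: delta a.
  apply/ffunP => x; rewrite !ffunE scale_regE.
  have [->|ne_xa] := eqVneq x a.
    rewrite ba mul1r mulr1 /mfact; congr (_ * _%:R); apply: eq_bigr => i _.
    by rewrite ffactnn.
  rewrite mulr0; have [bx|_] := boolP (b x); last by rewrite !mul0r.
  suff [i lt_xa] : exists i, (expo x i < expo a i)%N.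
    by rewrite (bigD1 i) //= ffact_small // mul0n mulr0.
  apply/existsP; apply: contraNT ne_xa; rewrite negb_exists => /forallP le_ax.
  have le : (expo a <= expo x)%MM by apply/mnm_lepP => i; rewrite leqNgt le_ax.
  apply/eqP/expo_inj; rewrite -(submK le).
  have : mdeg (expo x - expo a)%MM = 0%N.
    have := degb _ bx; rewrite -(degb _ ba) -{1}(submK le) mdegD.
    by move=> /eqP; rewrite -{2}[mdeg (expo a)]add0n eqn_add2r => /eqP.
  by move/eqP; rewrite mdeg_eq0 => /eqP ->; rewrite add0m.
have nz : rowpow v (expo a) * (mfact (expo a))%:R != 0.
  rewrite mulf_neq0 ?rowpow_neq0 // natf_eq0 -lt0n.
  by apply: prodn_gt0 => i; apply: fact_gt0.
by rewrite rpredZeq (negPf nz).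
Qed.

End Lattice.

(** * From forms to functions on exponents *)

Section Coefficients.
Variables (F : fieldType) (n R : nat).
Hypothesis charF0 : [pchar F] =i pred0.

Notation T := {ffun 'I_n.+1 -> 'I_R.+1}.
Notation V := {ffun T -> F^o}.
Implicit Types (b : pred T) (v : 'rV[F]_n.+1) (a : T) (m : 'X_{1..n.+1}).

Lemma fact_neq0 r : (r`!)%:R != 0 :> F.
Proof. by rewrite natf_eq0 // -lt0n fact_gt0. Qed.

Lemma mfact_neq0 m : (mfact m)%:R != 0 :> F.
Proof. by rewrite natf_eq0 // -lt0n; apply: prodn_gt0 => i; apply: fact_gt0. Qed.

(* The factor a! turns multiplication by a power of a linear form into
   multiplication by a polynomial function, by the multinomial theorem. *)
Definition coeffun b (f : {mpoly F[n.+1]}) : V :=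
  [ffun a => (b a)%:R * ((mfact (expo a))%:R * f@_(expo a))].

Lemma coeffun_is_linear b : linear (coeffun b).
Proof.
move=> c f g; apply/ffunP => a; rewrite !ffunE scale_regE.
by rewrite mcoeffD mcoeffZ; ring.
Qed.
HB.instance Definition _ b :=
  GRing.isLinear.Build F {mpoly F[n.+1]} V _ (coeffun b) (coeffun_is_linear b).

Lemma coeffun_lfun b k : exists g : 'Hom(dhomog n.+1 F k, V),
  forall f : dhomog n.+1 F k, g f = coeffun b (val f).
Proof.
by apply: linear_lfun => c f g; rewrite !linearP.
Qed.

(** The coefficient at [a] is that of [linform v ^+ r] at [a - m], namely [r! v^(a-m) / (a-m)!], and
    [a! / (a-m)!] is a product of falling factorials. The factor [v^m] turns [v^(a-m)] into [v^a]
    without a division. *)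
Lemma coeffun_monomial b k v r m :
    (forall a, b a -> mdeg (expo a) = k) -> (mdeg m + r)%N = k ->
  rowpow v m *: coeffun b ('X_[m] * linform v ^+ r) =
  (r`!)%:R *: fallfun b v m.
Proof.
move=> degb degm; apply/ffunP => a; rewrite !ffunE !scale_regE.
have [ba|_] := boolP (b a); last by rewrite !mul0r !mulr0.
rewrite ['X_[m] * _]mulrC mcoeffMXm.
case: ifPn => [le_ma|/mnm_lepP nle]; last first.
  suff [i lt_am] : exists i, (expo a i < m i)%N.
    by rewrite [in RHS](bigD1 i) //= ffact_small // mul0n !mulr0.
  apply/existsP; apply: contra_notT nle; rewrite negb_exists => /forallP le i.
  by rewrite leqNgt.
have degB : mdeg (expo a - m)%MM = r.
  have := degb _ ba; rewrite -{1}(submK le_ma) mdegD -degm addnC => /eqP.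
  by rewrite eqn_add2l => /eqP.
have := mfact_linformX v degB.
have -> : rowpow v (expo a) = rowpow v (expo a - m)%MM * rowpow v m.
  by rewrite -rowpowD submK.
rewrite (mfactB le_ma) natrM.
have ringE (A M c w f u : F) : M * c = f * u ->
    w * (1 * (A * M * c)) = f * (1 * (u * w) * A).
  by move=> E; rewrite mul1r -mulrA E; ring.
exact: ringE.
Qed.

(** Monomial multiples of [linform v ^+ r] go to nonzero multiples of falling factorials of degree
    exactly [k - r]. These span all polynomial functions of degree at most [k - r], because
    [|a| = k] on [b]. *)
Lemma coeffun_powspace b k r v (g : 'Hom(dhomog n.+1 F k, V)) :
    (forall f : dhomog n.+1 F k, g f = coeffun b (val f)) ->
    (forall a, b a -> mdeg (expo a) = k) -> (r <= k)%N ->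
    (forall i, v 0 i != 0) ->
  (g @: powspace k r v)%VS = polyfun b v (k - r).
Proof.
move=> gE degb le_rk nzv; apply/eqP; rewrite eqEsubv; apply/andP; split.
  apply/subvP => _ /memv_imgP [f /powspaceP [q hq fE] ->].
  rewrite gE fE [q]mpolyE mulr_suml linear_sum /=.
  rewrite big_seq; apply: rpred_sum => m /(dhomogP _ _ _ hq) /= degm.
  rewrite -scalerAl linearZ /=; apply: rpredZ.
  have := @coeffun_monomial b k v r m degb; rewrite degm subnK // => /(_ erefl).
  move/(canRL (scalerK (rowpow_neq0 m nzv))) => ->.
  by apply/rpredZ/rpredZ; rewrite -degm fallfun_polyfun.
apply: (polyfun_fallfun charF0 degb) => // [|m degm]; first exact: leq_subr.
have := @coeffun_monomial b k v r m degb; rewrite degm subnK // => /(_ erefl).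
move/esym/(canRL (scalerK (fact_neq0 r))) => ->.
apply/rpredZ/rpredZ.
have hm : 'X_[F, m] \is (k - r).-homog by rewrite dhomogX /= degm.
have hq := mul_linform_homog v le_rk hm.
by rewrite -(val_indhomog hq) -gE memv_img // mem_powspace.
Qed.

(** These are the exponents of the monomials of degree [k] that survive modulo the [x_i^(r_i)].
    Integer arguments accommodate the reflected data, which can be negative. *)
Definition box (r : 'I_n.+1 -> int) (k : int) : pred T :=
  fun a => [forall i, (a i)%:Z < r i] && ((mdeg (expo a))%:Z == k).

Lemma box_deg r (k : nat) a : box r k a -> mdeg (expo a) = k.
Proof. by case/andP=> _ /eqP []. Qed.

Lemma expo_surj m : (mdeg m <= R)%N -> exists a, expo a = m.
Proof.
move=> le_mR; exists [ffun i => inord (m i)]; apply/mnmP => i.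
rewrite mnmE ffunE inordK // ltnS; apply: leq_trans le_mR.
by rewrite mdegE (bigD1 i) //= leq_addr.
Qed.

Lemma linform_delta i : linform (delta_mx 0 i : 'rV[F]_n.+1) = 'X_i.
Proof.
rewrite /linform (bigD1 i) //= mxE !eqxx scale1r big1 ?addr0 // => j ne_ji.
by rewrite mxE (negPf ne_ji) andbF scale0r.
Qed.

Section Hp.
Variables (l : nat) (hl : (n.+1 < l)%N).
Let e := widen_ord (ltnW hl).

(** The position in which the Cremona map is visible: the points after the coordinate vectors lie in
    the torus, where coordinates can be inverted. *)
Definition std_position (p : 'I_l -> 'rV[F]_n.+1) :=
  (forall i, p (e i) = delta_mx 0 i) /\
  (forall j : 'I_l, (n < j)%N -> forall i, p j 0 i != 0).

Lemma inord_widen (j : 'I_l) : (j <= n)%N -> j = e (inord j).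
Proof. by move=> le_jn; apply: val_inj; rewrite /= inordK. Qed.

(** [coeffun b] maps the forms of degree [k] onto the functions on the box, and its kernel, spanned
    by monomials divisible by some [x_i^(r_i)], lies in the sum of the [powspace]. Hence the
    codimension of that sum is preserved. *)
Lemma hp_std_position (p : 'I_l -> 'rV[F]_n.+1) (r : 'I_l -> nat) (k : nat) :
    (k <= R)%N -> std_position p ->
  let b := box (fun i => Posz (r (e i))) k in
  hp p r k = (\dim (supported F b) - \dim
    (\sum_(j < l | (n < j)%N)
       (if (r j <= k)%N then polyfun b (p j) (k - r j) else 0%VS))%VS)%N.
Proof.
move=> le_kR [pe nzp] b.
have degb a : b a -> mdeg (expo a) = k by apply: box_deg.
have [g gE] := coeffun_lfun b k.
set U := (\sum_(i < l) powspace k (r i) (p i))%VS.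
have imgU : (g @: U)%VS = (\sum_(j < l | (n < j)%N)
    (if (r j <= k)%N then polyfun b (p j) (k - r j) else 0%VS))%VS.
  rewrite limg_sum (bigID (fun j : 'I_l => (n < j)%N)) /=.
  rewrite [X in (_ + X)%VS]big1 ?addv0 => [|j].
    apply: eq_bigr => j lt_nj; case: ifPn => [le_rk|nle_rk].
      by apply: coeffun_powspace => //; apply: nzp.
    by rewrite /powspace (negPf nle_rk) limg0.
  (* For [j <= n] the point is a coordinate vector, and multiples of [x_j^(r_j)] have no monomial in
     the box. *)
  rewrite -leqNgt => /inord_widen Ej; apply/eqP; rewrite -subv0.
  apply/subvP => _ /memv_imgP [f /powspaceP [q _ fE] ->].
  rewrite memv0 gE; apply/eqP/ffunP => a; rewrite !ffunE.
  have [/andP [/forallP ba _]|_] := boolP (b a); last by rewrite mul0r.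
  rewrite fE Ej pe linform_delta mpolyXn mcoeffMXm ifF ?mulr0 //.
  apply/negP => /mnm_lepP /(_ (inord j)); rewrite mulmnE mnm1E eqxx mul1n mnmE.
  by rewrite leqNgt -ltz_nat ba.
have kerU : (lker g <= U)%VS.
  apply/subvP => f; rewrite memv_ker gE => /eqP f0.
  have hf := dhomog_is_dhomog f; move/dhomogP: (hf) => degf.
  have -> : f = \sum_(m <- msupp (val f))
      (val f)@_m *: @indhomog n.+1 F k 'X_[m].
    apply: val_inj; rewrite linear_sum /= {1}[val f]mpolyE !big_seq.
    apply: eq_bigr => m /degf /= degm.
    by rewrite val_indhomog // dhomogX /= degm.
  rewrite big_seq; apply: rpred_sum => m fm; apply: rpredZ.
  have degm : mdeg m = k := degf _ fm.
  have [i le_ri] : exists i, (r (e i) <= m i)%N.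
    apply/existsP; apply: contraTT fm; rewrite negb_exists => /forallP lt_mr.
    have [|a Ea] := @expo_surj m; first by rewrite degm.
    have /ffunP/(_ a) := f0; rewrite !ffunE.
    have -> : b a.
      apply/andP; split; last by rewrite Ea degm.
      apply/forallP => i; have -> : (a i : nat) = m i by rewrite -Ea mnmE.
      by rewrite ltz_nat ltnNge.
    rewrite mul1r Ea => /eqP; rewrite mulf_eq0 (negPf (mfact_neq0 m)) /=.
    by rewrite mcoeff_eq0.
  have le_mk : (m i <= k)%N by rewrite -degm mdegE (bigD1 i) //= leq_addr.
  have le_rm : (U_(i) *+ r (e i) <= m)%MM.
    apply/mnm_lepP => j; rewrite mulmnE mnm1E.
    by have [<-|_] := eqVneq i j; rewrite ?mul1n ?mul0n.
  suff: @indhomog n.+1 F k 'X_[m] \in powspace k (r (e i)) (p (e i)).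
    by apply: subvP; apply: sumv_sup (subvv _).
  rewrite -(submK le_rm) mpolyXD -mpolyXn pe -linform_delta mem_powspace //.
    exact: leq_trans le_mk.
  rewrite dhomogX /= -(eqn_add2r (mdeg (U_(i) *+ r (e i))%MM)) -mdegD submK //.
  by rewrite degm mdegMn mdeg1 mul1n subnK // (leq_trans le_ri).
have imgg : limg g = supported F b.
  apply/eqP; rewrite eqEsubv; apply/andP; split.
    apply/subvP => _ /memv_imgP [f _ ->]; apply/supportedP => a /negPf ba.
    by rewrite gE ffunE ba mul0r.
  apply: supported_sub => a ba.
  have hm : 'X_[F, expo a] \is k.-homog.
    by rewrite dhomogX /= (degb _ ba).
  suff -> : delta F a = ((mfact (expo a))%:R)^-1 *: g (@indhomog n.+1 F k 'X_[expo a]).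
    by rewrite rpredZ // memv_img // memvf.
  apply/ffunP => x; rewrite gE !ffunE scale_regE val_indhomog // mcoeffX.
  have [->|ne_xa] := eqVneq x a.
    by rewrite ba eqxx mul1r mulr1 mulVf // mfact_neq0.
  by rewrite (inj_eq (@expo_inj _ _)) eq_sym (negPf ne_xa) !mulr0.
(* Rank-nullity is applied on the whole space and on [U]; both kernels are [lker g], so they
   cancel. *)
rewrite /hp -/U -imgU -imgg -(limg_ker_dim g fullv) -(limg_ker_dim g U).
by rewrite capfv (capv_idPr kerU) subnDl.
Qed.

End Hp.
End Coefficients.

(** * The Cremona reflection *)

Section Reflection.
Variables (F : fieldType) (n R : nat).
Hypothesis charF0 : [pchar F] =i pred0.

Notation T := {ffun 'I_n.+1 -> 'I_R.+1}.
Notation V := {ffun T -> F^o}.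
Implicit Types (v : 'rV[F]_n.+1) (a : T) (r : 'I_n.+1 -> int) (k : int).

(** [inord] and the absolute value make the map total; on the relevant box, with [R] large enough,
    it is [a_i |-> r_i - 1 - a_i]. *)
Definition refl r a : T := [ffun i => inord `|(r i - 1 - (a i)%:Z)%R|%N].
Definition rowinv v : 'rV[F]_n.+1 := \row_i (v 0 i)^-1.

Lemma rowinvK : involutive rowinv.
Proof. by move=> v; apply/rowP => i; rewrite !mxE invrK. Qed.

Lemma mdeg_expo a : (mdeg (expo a))%:Z = \sum_i (a i)%:Z.
Proof.
by rewrite mdegE (big_morph Posz PoszD erefl); apply: eq_bigr => i _; rewrite mnmE.
Qed.

Lemma boxE r k a :
  box r k a = [forall i, (a i)%:Z < r i] && (\sum_i (a i)%:Z == k).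
Proof. by rewrite /box mdeg_expo. Qed.

Lemma sum_refl r a :
  \sum_i (r i - 1 - (a i)%:Z) = \sum_i r i - n.+1%:Z - \sum_i (a i)%:Z.
Proof.
rewrite !sumrB; congr (_ - _ - _).
by rewrite sumr_const card_ord natz.
Qed.

(** The reflected coordinates are nonnegative and add up to [k], so each is at most [R] and no
    truncation occurs. *)
Lemma reflE r k a : box r (\sum_i r i - n.+1%:Z - k) a -> k <= R ->
  forall i, (refl r a i)%:Z = r i - 1 - (a i)%:Z.
Proof.
rewrite boxE => /andP [/forallP lt_ar /eqP suma] le_kR i.
have ge0 j : 0 <= r j - 1 - (a j)%:Z by have := lt_ar j; lia.
have le_R : r i - 1 - (a i)%:Z <= R.
  apply: le_trans le_kR; have := sum_refl r a.
  rewrite suma subKr (bigD1 i) //= => <-.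
  by rewrite lerDl sumr_ge0.
rewrite ffunE inordK; first by rewrite gez0_abs.
by have := ge0 i; lia.
Qed.

Lemma refl_box r k k' a : k' = \sum_i r i - n.+1%:Z - k -> k <= R ->
  box r k' a -> box r k (refl r a).
Proof.
move=> -> le_kR ba; have E := reflE ba le_kR; move: ba; rewrite !boxE.
move=> /andP [/forallP lt_ar /eqP suma]; apply/andP; split.
  by apply/forallP => i; rewrite E; lia.
rewrite (eq_bigr _ (fun i _ => E i)) sum_refl suma.
by apply/eqP; ring.
Qed.

Lemma reflK r k k' a : k' = \sum_i r i - n.+1%:Z - k -> k <= R -> k' <= R ->
  box r k' a -> refl r (refl r a) = a.
Proof.
move=> Ek' le_kR le_kR' ba; have ba' := refl_box Ek' le_kR ba.
rewrite Ek' in ba; have Ek : k = \sum_i r i - n.+1%:Z - k' by rewrite Ek'; ring.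
rewrite Ek in ba'; apply/ffunP => i; apply: val_inj.
apply/eqP; rewrite -eqz_nat; apply/eqP.
by rewrite (reflE ba') // (reflE ba) //; ring.
Qed.

(** A negative degree [k - r_j] gives the zero space, in agreement with [powspace] for [r_j > k]. *)
Definition polyfunz (b : pred T) v (z : int) : {vspace V} :=
  if z is Posz d then polyfun b v d else 0%VS.

Lemma polyfunz_supported (b : pred T) v z : (polyfunz b v z <= supported F b)%VS.
Proof. by case: z => d; rewrite /= ?sub0v ?polyfun_supported. Qed.

Section Fixed.
Variables (r : 'I_n.+1 -> int) (k k' : int).
Hypothesis (Ek' : k' = \sum_i r i - n.+1%:Z - k).
Hypothesis (le_kR : k <= R) (le_kR' : k' <= R).
Let b : pred T := box r k.
Let b' : pred T := box r k'.

Lemma reflfun_lfun : exists g : 'End(V),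
  forall f, g f = [ffun a => (b' a)%:R * f (refl r a) : F^o].
Proof.
apply: linear_lfun => c f f'; apply/ffunP => a; rewrite !ffunE !scale_regE.
by rewrite mulrDr; congr (_ + _); apply: mulrCA.
Qed.

Lemma refl_natr a i : b' a ->
  (refl r a i)%:R = (r i - 1)%:~R - (a i)%:R :> F.
Proof.
rewrite /b' Ek' => ba; have E := reflE ba le_kR i.
by rewrite -[LHS]/((refl r a i)%:Z%:~R) E rmorphB.
Qed.

Lemma refl_rowpow v a : (forall i, v 0 i != 0) -> b' a ->
  rowpow v (expo (refl r a)) =
  (\prod_i v 0 i ^ (r i - 1)) * rowpow (rowinv v) (expo a).
Proof.
rewrite /b' Ek' => nzv ba; rewrite -big_split /=; apply: eq_bigr => i _.
have E := reflE ba le_kR i.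
by rewrite !mxE !mnmE exprnP E expfzDr // -exprnN exprVn.
Qed.

Section Image.
Variable g : 'End(V).
Hypothesis gE : forall f, g f = [ffun a => (b' a)%:R * f (refl r a) : F^o].

(** Under the reflection, [v^a] becomes a constant times [(v^-1)^a] and each coordinate becomes the
    affine function [r_i - 1 - a_i], so degrees do not grow. *)
Lemma reflfun_polyfun v d : (forall i, v 0 i != 0) ->
  (g @: polyfun b v d <= polyfun b' (rowinv v) d)%VS.
Proof.
move=> nzv; suff sub f : f \in polyfun b v d -> g f \in polyfun b' (rowinv v) d.
  by apply/subvP => _ /memv_imgP [f Wf ->]; apply: sub.
rewrite memv_preim; move: f; apply/subvP; elim: d => [|d IHd].
  rewrite -memvE -memv_preim; apply/vlineP.
  exists (\prod_i v 0 i ^ (r i - 1)); rewrite gE; apply/ffunP => a; rewrite !ffunE.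
  have [b'a|_] := boolP (b' a); last by rewrite !mul0r scaler0.
  rewrite [b _](refl_box Ek' le_kR b'a) scale_regE !mul1r.
  exact: refl_rowpow.
apply: polyfun_sub => [|f i] => [|/(subvP IHd)]; rewrite -?memv_preim.
  move=> f /(subvP IHd); rewrite -!memv_preim.
  by apply: subvP; apply: polyfunS.
move=> Wgf.
have -> : g (mulfun (fun a => (a i)%:R) f) =
    (r i - 1)%:~R *: g f - mulfun (fun a => (a i)%:R) (g f).
  apply/ffunP => a; rewrite !gE !ffunE scale_regE.
  have [b'a|_] := boolP (b' a); last by rewrite !mul0r !mulr0 subr0.
  have := refl_natr i b'a; rewrite ffunE => ->.
  by rewrite !mul1r mulrBl.
rewrite rpredB ?polyfun_mulcoord // rpredZ //.
exact: subvP (polyfunS _ _ _) _ Wgf.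
Qed.

Lemma reflfun_supported : (g @: supported F b <= supported F b')%VS.
Proof.
apply/subvP => _ /memv_imgP [f _ ->]; apply/supportedP => a /negPf b'a.
by rewrite gE ffunE b'a mul0r.
Qed.

(** The reflection exchanges the two boxes, so a function supported on [b] can be recovered from its
    image. *)
Lemma dim_reflfun (U : {vspace V}) :
  (U <= supported F b)%VS -> \dim (g @: U) = \dim U.
Proof.
move=> supU; apply: limg_dim_eq; apply/eqP; rewrite -subv0.
apply/subvP => f /memv_capP [/(subvP supU) /supportedP suppf].
rewrite memv_ker memv0 gE => /eqP gf0; apply/eqP/ffunP => a; rewrite ffunE.
have [ba|/suppf //] := boolP (b a).
have Ek : k = \sum_i r i - n.+1%:Z - k' by rewrite Ek'; ring.
have /ffunP/(_ (refl r a)) := gf0; rewrite !ffunE [b' _](refl_box Ek) //.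
by rewrite mul1r (reflK Ek).
Qed.

End Image.

Lemma dim_supported_le : (\dim (supported F b) <= \dim (supported F b'))%N.
Proof.
have [g gE] := reflfun_lfun.
by rewrite -(dim_reflfun gE (subvv _)) dimvS ?reflfun_supported.
Qed.

Lemma dim_polyfun_le (I : finType) (P : pred I) (p : I -> 'rV[F]_n.+1)
    (z : I -> int) : (forall j, P j -> forall i, p j 0 i != 0) ->
  (\dim (\sum_(j | P j) polyfunz b (p j) (z j))%VS <=
   \dim (\sum_(j | P j) polyfunz b' (rowinv (p j)) (z j))%VS)%N.
Proof.
move=> nzp; have [g gE] := reflfun_lfun.
rewrite -(dim_reflfun gE); last first.
  by apply/subv_sumP => j _; apply: polyfunz_supported.
rewrite dimvS // limg_sum; apply/subv_sumP => j Pj.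
apply: subv_trans (sumv_sup j Pj (subvv _)).
by case: (z j) => d /=; rewrite ?limg0 ?sub0v //; apply/reflfun_polyfun/nzp.
Qed.

End Fixed.
End Reflection.

(** * Invariance of the codimension for points in standard position *)

Section Symmetry.
Variables (F : fieldType) (n l : nat) (hl : (n.+1 < l)%N).
Hypothesis charF0 : [pchar F] =i pred0.
Let e := widen_ord (ltnW hl).
Implicit Types (p : 'I_l -> 'rV[F]_n.+1) (r : 'I_l -> int) (k : int).

Definition hpz p r k : nat :=
  if (k < 0) || [exists i, r i < 0] then 0%N
  else hp p (fun i => `|r i|%N) `|k|%N.

Definition codim_box R p r k : nat :=
  let b : pred {ffun 'I_n.+1 -> 'I_R.+1} := box (fun i => r (e i)) k in
  (\dim (supported F b)
   - \dim (\sum_(j < l | (n < j)%N) polyfunz b (p j) (k - r j))%VS)%N.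

Lemma dim_supported0 R (b : pred {ffun 'I_n.+1 -> 'I_R.+1}) :
  (forall a, ~~ b a) -> \dim (supported F b) = 0%N.
Proof.
move=> b0; apply/eqP; rewrite dimv_eq0 -subv0.
by apply: supported_sub => a; rewrite (negPf (b0 a)).
Qed.

(** The conventional value 0 has to be matched: the box is empty if [k < 0] or if some [r_j < 0]
    with [j <= n], and for [r_j < 0] with [j > n] the polynomials of degree at most [k - r_j > k]
    give all functions on the box. *)
Lemma hpz_std_position (R : nat) p r k :
  k <= R -> std_position hl p -> hpz p r k = codim_box R p r k.
Proof.
move=> le_kR goodp; have [pe nzp] := goodp; rewrite /hpz /codim_box.
have [lt_k0|ge_k0] /= := ltP k 0.
  rewrite dim_supported0 // => a; rewrite boxE negb_and; apply/orP; right.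
  have : 0 <= \sum_i (a i)%:Z by apply: sumr_ge0.
  by move=> ?; apply/eqP; lia.
case: ifPn => [/existsP [j lt_rj0]|].
  have [lt_nj|le_jn] := ltnP n j; last first.
    rewrite dim_supported0 // => a; rewrite boxE negb_and; apply/orP; left.
    rewrite negb_forall; apply/existsP; exists (inord j).
    by have := inord_widen hl le_jn; rewrite -/e => <-; lia.
  apply/esym/eqP; rewrite subn_eq0; apply/dimvS.
  apply: subv_trans (sumv_sup j lt_nj (subvv _)).
  case: k ge_k0 le_kR => // k _ le_kR.
  have -> : k%:Z - r j = Posz (k + `|r j|)%N by lia.
  rewrite -(polyfun_full charF0 (k := k) (nzp j lt_nj)) => [|a].
    by apply: polyfun_mono; apply: leq_addr.
  exact: box_deg.
rewrite negb_exists => /forallP ge_r0.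
have Er i : r i = `|r i|%N by have := ge_r0 i; lia.
case: k ge_k0 le_kR => // k _ le_kR; rewrite lez_nat in le_kR.
rewrite (hp_std_position charF0 _ le_kR goodp) -/e.
have -> : (fun i => Posz `|r (e i)|%N) = (fun i => r (e i)).
  by apply: functional_extensionality => i; rewrite -Er.
congr (_ - \dim _)%N; apply: eq_bigr => j _.
rewrite [in RHS]Er; case: leqP => [le_rk|lt_kr].
  by rewrite subzn.
by case E: (_ - _)%R => [d|d] //; exfalso; lia.
Qed.

Lemma codim_box_cremona (R : nat) p r k r' k' :
    k' = \sum_i r (e i) - n.+1%:Z - k ->
    (forall i, r' (e i) = r (e i)) ->
    (forall j : 'I_l, (n < j)%N -> k - r j = k' - r' j) ->
    k <= R -> k' <= R -> std_position hl p ->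
  codim_box R p r k = codim_box R (fun j => rowinv (p j)) r' k'.
Proof.
move=> Ek' Er' Ez le_kR le_kR' [pe nzp]; rewrite /codim_box.
have -> : (fun i => r' (e i)) = (fun i => r (e i)).
  exact: functional_extensionality.
under [in RHS]eq_bigr => j lt_nj do rewrite -Ez //.
have Ek : k = \sum_i r (e i) - n.+1%:Z - k' by rewrite Ek'; ring.
congr (_ - _)%N; apply/eqP; rewrite eqn_leq; apply/andP; split.
- exact: dim_supported_le Ek' _ _.
- exact: dim_supported_le Ek _ _.
- exact: (dim_polyfun_le Ek' le_kR le_kR' _ nzp).
(* The reverse inequality starts from the inverted points, and inverting twice restores [p]. *)
under [X in (_ <= \dim X)%N]eq_bigr => j lt_nj do rewrite -[p j]rowinvK.
apply: (dim_polyfun_le Ek le_kR' le_kR) => j lt_nj i.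
by rewrite mxE invr_neq0 ?nzp.
Qed.

(* [rowinv] fixes the standard basis vectors because [0^-1 = 0]. *)
Lemma std_position_rowinv p :
  std_position hl p -> std_position hl (fun j => rowinv (p j)).
Proof.
move=> [pe nzp]; split=> [i|j lt_nj i]; last by rewrite mxE invr_neq0 ?nzp.
apply/rowP => j; rewrite mxE pe mxE eqxx /=.
by case: (j == i); rewrite ?invr1 ?invr0.
Qed.

Lemma hpz_cremona p r k r' k' :
    k' = \sum_i r (e i) - n.+1%:Z - k ->
    (forall i, r' (e i) = r (e i)) ->
    (forall j : 'I_l, (n < j)%N -> k - r j = k' - r' j) ->
    std_position hl p ->
  hpz p r k = hpz (fun j => rowinv (p j)) r' k'.
Proof.
move=> Ek' Er' Ez goodp; pose R := (`|k| + `|k'|)%N.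
have le_kR : k <= R by rewrite /R; lia.
have le_kR' : k' <= R by rewrite /R; lia.
rewrite (hpz_std_position r le_kR goodp).
rewrite (hpz_std_position r' le_kR' (std_position_rowinv goodp)).
exact: codim_box_cremona.
Qed.

End Symmetry.

(** * Semicontinuity and change of coordinates *)

(** With [B] a right inverse at [t0], the polynomial [det (M B)] is 1 at [t0], and wherever it is
    nonzero [M] still has a right inverse. *)
Lemma row_free_generic (F : fieldType) (N D : nat) (M : 'M[{poly F}]_(N, D))
    (t0 : F) : row_free (map_mx (horner_eval t0) M) ->
  exists2 d : {poly F}, d.[t0] != 0 &
    forall t, d.[t] != 0 -> row_free (map_mx (horner_eval t) M).
Proof.
move=> /row_freeP [B MB1]; pose d := \det (M *m map_mx polyC B).
have dE t : d.[t] = \det (map_mx (horner_eval t) M *m B).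
  rewrite -/(horner_eval t d) -det_map_mx map_mxM /=; congr (\det (_ *m _)).
  by apply/matrixP => i j; rewrite !mxE /= /horner_eval hornerC.
exists d => [|t]; first by rewrite dE MB1 det1 oner_neq0.
rewrite dE -unitfE -/(_ \in unitmx) => unitMB; apply/row_freeP.
by exists (B *m invmx (map_mx (horner_eval t) M *m B)); rewrite mulmxA mulmxV.
Qed.

(** In characteristic 0 the elements [0, ..., size d - 1] are distinct, and they are too many to be
    all roots of [d]. *)
Lemma exists_nonroot (F : fieldType) (d : {poly F}) :
  [pchar F] =i pred0 -> d != 0 -> exists t, d.[t] != 0.
Proof.
move=> charF0 nzd; pose s := [seq (i%:R : F) | i <- iota 0 (size d)].
have uniq_s : uniq s.
  rewrite map_inj_uniq ?iota_uniq // => i j.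
  wlog le_ij : i j / (i <= j)%N => [hw E|].
    by have [le|/ltnW le] := leqP i j; [apply: hw | apply/esym/hw].
  move=> E; apply/eqP; rewrite eqn_leq le_ij -subn_eq0 -(natf_eq0 charF0).
  by rewrite natrB // E subrr eqxx.
suff /allPn [t _ nroot] : ~~ all (root d) s by exists t; rewrite -rootE.
apply/negP => /(max_poly_roots nzd) /(_ uniq_s).
by rewrite size_map size_iota ltnn.
Qed.

Section Family.
Variables (F : fieldType) (n l k : nat) (r : 'I_l -> nat).
Implicit Types (p : 'I_l -> 'rV[F]_n.+1) (f : dhomog n.+1 F k).

Definition powsum p := (\sum_(i < l) powspace k (r i) (p i))%VS.

Definition coef_degrees (Q : 'I_l -> {mpoly F[n.+1]}) := forall i,
  ((r i <= k)%N -> Q i \is (k - r i).-homog) /\ ((k < r i)%N -> Q i = 0).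

Lemma mem_powsumP p f : f \in powsum p ->
  exists2 Q, coef_degrees Q & val f = \sum_i Q i * linform (p i) ^+ r i.
Proof.
case/memv_sumP => fs mem_fs ->.
have /fin_all_exists [Q QP] : forall i, exists q : {mpoly F[n.+1]},
    [/\ (r i <= k)%N -> q \is (k - r i).-homog, (k < r i)%N -> q = 0
      & val (fs i) = q * linform (p i) ^+ r i].
  move=> i; have := mem_fs i isT; have [le_rk|lt_kr] := leqP (r i) k.
    by case/powspaceP => q hq fE; exists q.
  rewrite /powspace leqNgt lt_kr memv0 => /eqP ->.
  by exists 0; split; rewrite ?mul0r.
exists Q => [i|]; first by case: (QP i).
by rewrite linear_sum; apply: eq_bigr => i _; case: (QP i).
Qed.

Lemma mem_powsum p f Q : coef_degrees Q ->
  val f = \sum_i Q i * linform (p i) ^+ r i -> f \in powsum p.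
Proof.
move=> hQ fE.
have termE i : val (@indhomog n.+1 F k (Q i * linform (p i) ^+ r i)) =
    Q i * linform (p i) ^+ r i.
  apply: val_indhomog; have [hQi Qi0] := hQ i.
  have [le_rk|/Qi0 ->] := leqP (r i) k; last by rewrite mul0r rpred0.
  by rewrite mul_linform_homog ?hQi.
have -> : f = \sum_i @indhomog n.+1 F k (Q i * linform (p i) ^+ r i).
  apply: val_inj; rewrite fE linear_sum; apply: eq_bigr => i _.
  by rewrite /= termE.
apply: memv_sumr => i _; have [hQi Qi0] := hQ i.
have [le_rk|lt_kr] := leqP (r i) k; first by rewrite mem_powspace ?hQi.
suff -> : @indhomog n.+1 F k (Q i * linform (p i) ^+ r i) = 0 by apply: mem0v.
by apply: val_inj; rewrite termE Qi0 ?mul0r.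
Qed.

Lemma comb_powers_homog p Q : coef_degrees Q ->
  \sum_i Q i * linform (p i) ^+ r i \is k.-homog.
Proof.
move=> hQ; apply: rpred_sum => i _; have [hQi Qi0] := hQ i.
have [le_rk|/Qi0 ->] := leqP (r i) k; last by rewrite mul0r rpred0.
by rewrite mul_linform_homog ?hQi.
Qed.

Definition eval_points (P : 'I_l -> 'rV[{poly F}]_n.+1) (t : F) i : 'rV[F]_n.+1 :=
  map_mx (horner_eval t) (P i).

(** Lower semicontinuity of the dimension: write a basis at [t0] as combinations of powers, keep the
    multipliers [Q] and move the points. The coefficients of the resulting forms are polynomials in
    [t], and their independence at [t0] persists off the zeros of a determinant. *)
Lemma dim_powsum_generic (P : 'I_l -> 'rV[{poly F}]_n.+1) (t0 : F) :
  exists2 d : {poly F}, d.[t0] != 0 & forall t, d.[t] != 0 ->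
    (\dim (powsum (eval_points P t0)) <= \dim (powsum (eval_points P t)))%N.
Proof.
set U := powsum _; pose X := vbasis U.
have /fin_all_exists [Q QP] : forall s : 'I_(\dim U), exists Q, coef_degrees Q /\
    val (tnth X s) = \sum_i Q i * linform (eval_points P t0 i) ^+ r i.
  move=> s; have /mem_powsumP [Q hQ XE] := vbasis_mem (mem_tnth s X).
  by exists Q.
pose G s : {mpoly {poly F}[n.+1]} :=
  \sum_i map_mpoly polyC (Q s i) * (\sum_j P i 0 j *: 'X_j) ^+ r i.
have GE s t : map_mpoly (horner_eval t) (G s) =
    \sum_i Q s i * linform (eval_points P t i) ^+ r i.
  rewrite rmorph_sum; apply: eq_bigr => i _; rewrite rmorphM rmorphXn /=.
  congr (_ * _ ^+ _).
    by apply/mpolyP => m; rewrite !mcoeff_map_mpoly /= /horner_eval hornerC.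
  rewrite rmorph_sum; apply: eq_bigr => j _.
  by rewrite /= map_mpolyZ map_mpolyX mxE.
pose M : 'M_(_, _) := \matrix_(s < \dim U, c < #|{: 'X_{1..n.+1 < k.+1}}|)
  (G s)@_(enum_val c).
pose f t s : dhomog n.+1 F k := DHomog (comb_powers_homog (eval_points P t) (QP s).1).
have Mf t (c : 'rV_(\dim U)) :
  (c *m map_mx (horner_eval t) M == 0) = (\sum_s c 0 s *: f t s == 0).
  have E m : (\sum_s c 0 s *: val (f t s))@_m =
      \sum_s c 0 s * ((G s)@_m).[t].
    rewrite raddf_sum; apply: eq_bigr => s _.
    by rewrite /= mcoeffZ -GE mcoeff_map_mpoly.
  apply/eqP/eqP => [cM0|f0]; last first.
    apply/rowP => j; rewrite !mxE.
    under eq_bigr do rewrite !mxE.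
    rewrite -[LHS]E; have /(congr1 val) := f0; rewrite linear_sum /= => ->.
    by rewrite mcoeff0.
  apply: val_inj; rewrite linear_sum; apply/mpolyP => m /=; rewrite mcoeff0.
  have [le_mk|lt_km] := leqP (mdeg m) k; last first.
    apply: (dhomog_nemf_coeff (d := k) (mf := mdeg)); last by rewrite /= gtn_eqF.
    by apply: rpred_sum => s _; apply/rpredZ/comb_powers_homog/(QP s).1.
  have /rowP/(_ (enum_rank (BMultinom (le_mk : (mdeg m < k.+1)%N)))) := cM0.
  rewrite !mxE => cM0m; rewrite [LHS]E -[RHS]cM0m; apply: eq_bigr => s _.
  by rewrite !mxE enum_rankK.
have fX s : f t0 s = tnth X s by apply: val_inj; rewrite /= (QP s).2.
have freeM0 : row_free (map_mx (horner_eval t0) M).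
  apply: inj_row_free => c /eqP; rewrite Mf => /eqP cX0.
  have /freeP freeX := basis_free (vbasisP U).
  apply/rowP => s; rewrite mxE; apply: freeX s.
  by rewrite -[RHS]cX0; apply: eq_bigr => s _; rewrite fX (tnth_nth 0).
have [d d0 dP] := row_free_generic freeM0; exists d => // t /dP freeMt.
pose Y := [tuple f t s | s < \dim U].
have freeY : free Y.
  apply/freeP => c cY0 s.
  have /eqP : \row_s c s *m map_mx (horner_eval t) M == 0.
    rewrite Mf -[X in _ == X]cY0; apply/eqP; apply: eq_bigr => s' _.
    by rewrite mxE -tnth_nth tnth_mktuple.
  move/eqP; rewrite mulmx_free_eq0 // => /eqP/rowP/(_ s).
  by rewrite !mxE.
have <- : \dim <<Y>> = \dim U by rewrite (eqP freeY) size_tuple.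
apply: dimvS; apply/span_subvP => _ /mapP [s _ ->].
exact: mem_powsum (QP s).1 _.
Qed.

(** * Linear changes of coordinates *)

Definition subst (A : 'M[F]_n.+1) (q : {mpoly F[n.+1]}) : {mpoly F[n.+1]} :=
  q \mPo [tuple linform (row j A) | j < n.+1].

Lemma subst_is_linear A : linear (subst A).
Proof. by move=> c q1 q2; rewrite /subst linearP. Qed.
HB.instance Definition _ A :=
  GRing.isLinear.Build F {mpoly F[n.+1]} {mpoly F[n.+1]} _ (subst A)
    (subst_is_linear A).

Lemma substX A m : subst A 'X_[m] = \prod_j linform (row j A) ^+ m j.
Proof. by rewrite /subst comp_mpolyX; apply: eq_bigr => j _; rewrite tnth_mktuple. Qed.

Lemma subst_linform A v : subst A (linform v) = linform (v *m A).
Proof.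
rewrite /subst {1}/linform rmorph_sum /=.
under eq_bigr => j _ do rewrite comp_mpolyZ comp_mpolyXU -tnth_nth tnth_mktuple.
rewrite /linform; under eq_bigr do rewrite scaler_sumr.
rewrite exchange_big; apply: eq_bigr => i _; rewrite mxE scaler_suml.
by apply: eq_bigr => j _; rewrite scalerA mxE.
Qed.

Lemma subst_homog A d q : q \is d.-homog -> subst A q \is d.-homog.
Proof.
move=> hq; rewrite [q]mpolyE linear_sum /= big_seq.
apply: rpred_sum => m /(dhomogP _ _ _ hq) /= <-.
rewrite linearZ /=; apply: rpredZ; rewrite substX mdegE.
apply: (big_ind2 (fun (q' : {mpoly F[n.+1]}) d => q' \is d.-homog))
  => [|q1 d1 q2 d2|j _].
- exact: dhomog1.
- exact: dhomogM.
- by rewrite -[m j in X in _ \is X]mul1n; apply/dhomogMn/linform_homog.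
Qed.

Lemma substK A B q : A *m B = 1%:M -> subst B (subst A q) = q.
Proof.
move=> AB1; rewrite [q in LHS]mpolyE [in RHS](mpolyE q) [subst A _]linear_sum linear_sum.
apply: eq_bigr => m _; rewrite /= !linearZ /=; congr (_ *: _).
rewrite substX /subst rmorph_prod mpolyXE_id /=; apply: eq_bigr => j _.
rewrite rmorphXn /= -/(subst B _) subst_linform; congr (_ ^+ _).
by rewrite -row_mul AB1 row1 linform_delta.
Qed.

(** Substitution by [A] is injective, with left inverse the substitution by [B], and sends a power
    of the form [p i] to the same power of [p i *m A]. *)
Lemma dim_powsum_linear (A B : 'M[F]_n.+1) p : A *m B = 1%:M ->
  (\dim (powsum p) <= \dim (powsum (fun i => p i *m A)))%N.
Proof.
move=> AB1.
have homS f : subst A (val f) \is k.-homog.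
  by rewrite subst_homog ?dhomog_is_dhomog.
have [|g gE] := @linear_lfun F _ _ (fun f => DHomog (homS f)).
  by move=> c f f'; apply: val_inj; rewrite /= /subst linearP.
have injg : (powsum p :&: lker g = 0)%VS.
  apply/eqP; rewrite -subv0; apply/subvP => f /memv_capP [_].
  rewrite memv_ker memv0 gE => /eqP/(congr1 val) /= f0.
  by apply/eqP/val_inj; rewrite /= -(substK (val f) AB1) f0 /subst raddf0.
rewrite -(limg_dim_eq injg); apply: dimvS.
apply/subvP => _ /memv_imgP [f /mem_powsumP [Q hQ fE] ->]; rewrite gE.
apply: (mem_powsum (Q := fun i => subst A (Q i))) => [i|].
  have [hQi Qi0] := hQ i; split=> [/hQi|/Qi0 ->]; last by rewrite /subst raddf0.
  exact: subst_homog.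
rewrite /= fE /subst rmorph_sum; apply: eq_bigr => i _.
by rewrite rmorphM rmorphXn /= -!/(subst A _) subst_linform.
Qed.

End Family.

(** * The minimum is attained in standard position *)

Lemma natmin_spec (P : nat -> Prop) : (exists m, P m) ->
  P (natmin P) /\ forall m, P m -> (natmin P <= m)%N.
Proof.
move=> exP; rewrite /natmin.
case: ClassicalDescription.excluded_middle_informative => // ex.
case: ex_minnP => m Pm min_m; split.
  by move: Pm; case: ClassicalDescription.excluded_middle_informative.
by move=> m' Pm'; apply: min_m; case: ClassicalDescription.excluded_middle_informative.
Qed.

Section Minimum.
Variables (F : fieldType) (n l : nat) (hl : (n.+1 < l)%N).
Hypothesis charF0 : [pchar F] =i pred0.
Let e := widen_ord (ltnW hl).
Implicit Types (p : 'I_l -> 'rV[F]_n.+1).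

(** A reference configuration, the endpoint at [t = 1] of the line along which arbitrary points are
    deformed. *)
Definition simplex (j : 'I_l) : 'rV[F]_n.+1 :=
  if (j <= n)%N then delta_mx 0 (inord j) else const_mx 1.

Lemma simplex_widen i : simplex (e i) = delta_mx 0 i.
Proof. by rewrite /simplex leq_ord inord_val. Qed.

Lemma std_position_simplex : std_position hl simplex.
Proof.
split=> [|j lt_nj i]; first exact: simplex_widen.
by rewrite /simplex leqNgt lt_nj mxE oner_neq0.
Qed.

Lemma std_position_neq0 p : std_position hl p -> forall i, p i != 0.
Proof.
move=> [pe nzp] j; have [lt_nj|le_jn] := ltnP n j.
  by apply: contraNneq (nzp j lt_nj ord0) => ->; rewrite mxE.
rewrite (inord_widen hl le_jn) pe; apply/eqP => /rowP /(_ (inord j)) /eqP.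
by rewrite !mxE !eqxx oner_eq0.
Qed.

(** Move [p] along the line to [simplex]. Not losing dimension is ensured by an open condition that
    holds at [t = 0]; being carried to standard position by a linear map is ensured by one that
    holds at [t = 1]. Some [t] satisfies both. *)
Lemma dim_powsum_std_position p (r : 'I_l -> nat) k :
  exists2 p' : 'I_l -> 'rV[F]_n.+1, std_position hl p' &
    (\dim (powsum k r p : {vspace dhomog n.+1 F k}) <=
     \dim (powsum k r p' : {vspace dhomog n.+1 F k}))%N.
Proof.
pose P j : 'rV[{poly F}]_n.+1 :=
  map_mx polyC (p j) + 'X *: map_mx polyC (simplex j - p j).
have PE t j i : (P j 0 i).[t] = p j 0 i + t * (simplex j 0 i - p j 0 i).
  by rewrite !mxE !hornerE.
have P0 : eval_points P 0 = p.
  apply: functional_extensionality => j; apply/rowP => i.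
  by rewrite mxE /horner_eval PE mul0r addr0.
have P1 j i : (P j 0 i).[1] = simplex j 0 i by rewrite PE mul1r addrC subrK.
have [d d0 dP] := dim_powsum_generic k r P 0; rewrite P0 in dP.
pose M : 'M[{poly F}]_n.+1 := \matrix_(i, j) P (e i) 0 j.
have M1 : map_mx (horner_eval 1) M = 1%:M.
  apply/matrixP => i j; rewrite mxE [M _ _]mxE /horner_eval P1 simplex_widen !mxE eqxx /=.
  by rewrite eq_sym.
(* By Cramer's rule these are, up to the factor [det M], the coordinates of [P j] in the basis of
   the first [n + 1] points; the adjugate keeps them polynomial. *)
pose C j i := (P j *m \adj M) 0 i.
have CE t j i : (C j i).[t] =
    (eval_points P t j *m \adj (map_mx (horner_eval t) M)) 0 i.
  rewrite -map_mx_adj -map_mxM [RHS]mxE //.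
pose D := d * (\det M * \prod_(j < l | (n < j)%N) \prod_i C j i).
have nzD : D != 0.
  rewrite /D !mulf_neq0 //.
  - by apply: contraNneq d0 => ->; rewrite horner0.
  - apply/eqP => detM0; have /eqP := congr1 (horner_eval 1) detM0.
    by rewrite -det_map_mx M1 det1 /horner_eval horner0 oner_eq0.
  (* At [t = 1] the matrix is the identity and the remaining points are all-ones, so [C j i] takes
     the value 1. *)
  apply/prodf_neq0 => j lt_nj; apply/prodf_neq0 => i _.
  apply/eqP => C0; have := CE 1 j i; rewrite C0 horner0 M1.
  have -> : \adj (1%:M : 'M[F]_n.+1) = 1%:M.
    by rewrite -[LHS]mul1mx mul_mx_adj det1.
  rewrite mulmx1 mxE /horner_eval P1 /simplex leqNgt lt_nj mxE => /eqP.
  by rewrite eq_sym oner_eq0.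
have [t] := exists_nonroot charF0 nzD.
rewrite !hornerM !mulf_eq0 !negb_or => /and3P [dt detMt Ct].
set Mt := map_mx (horner_eval t) M.
have unitMt : Mt \in unitmx by rewrite unitmxE det_map_mx unitfE.
exists (fun j => eval_points P t j *m invmx Mt); last first.
  exact: leq_trans (dP t dt) (dim_powsum_linear _ _ _ (mulVmx unitMt)).
split=> [i|j lt_nj i].
  have -> : eval_points P t (e i) = row i Mt by apply/rowP => j; rewrite !mxE.
  by rewrite -row_mul mulmxV // row1.
rewrite /invmx unitMt -scalemxAr mxE mulf_neq0 //.
  by rewrite invr_neq0 // det_map_mx.
rewrite -CE; move: Ct; rewrite horner_prod => /prodf_neq0 /(_ j lt_nj).
by rewrite horner_prod => /prodf_neq0 /(_ i isT).
Qed.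

Lemma h_le (r : 'I_l -> int) k p : (forall i, p i != 0) ->
  (h F n r k <= hpz p r k)%N.
Proof.
move=> nzp; rewrite /h /hpz; case: ifP => // _.
have [|_ min] := natmin_spec (P := fun m => exists p : 'I_l -> 'rV[F]_(n.+1),
  (forall i, p i != 0) /\ hp p (fun i => `|r i|%N) `|k|%N = m).
  by exists (hp p (fun i => `|r i|%N) `|k|%N), p.
by apply: min; exists p.
Qed.

Lemma h_std_position (r : 'I_l -> int) k :
  exists2 p : 'I_l -> 'rV[F]_n.+1, std_position hl p & hpz p r k = h F n r k.
Proof.
suff [p goodp le_p] : exists2 p : 'I_l -> 'rV[F]_n.+1, std_position hl p &
    (hpz p r k <= h F n r k)%N.
  exists p => //; apply/eqP; rewrite eqn_leq le_p h_le //.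
  exact: std_position_neq0 goodp.
rewrite /h /hpz; case: ifP => _.
  by exists simplex; first exact: std_position_simplex.
have [|[p [nzp <-]] _] := natmin_spec (P := fun m =>
  exists p : 'I_l -> 'rV[F]_(n.+1),
  (forall i, p i != 0) /\ hp p (fun i => `|r i|%N) `|k|%N = m).
  exists (hp simplex (fun i => `|r i|%N) `|k|%N), simplex; split=> //.
  exact: std_position_neq0 std_position_simplex.
(* A larger sum of power spaces gives a smaller codimension, so [p'] does at least as well as the
   minimiser [p]. *)
have [p' goodp' le_dim] := dim_powsum_std_position p (fun i => `|r i|%N) `|k|%N.
by exists p' => //; apply: leq_sub2l.
Qed.

(** A minimiser for [(r, k)] in standard position reflects to an admissible choice of points for
    [(r', k')] with the same value. *)
Lemma h_cremona_le (r r' : 'I_l -> int) (k k' : int) :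
    k' = \sum_i r (e i) - n.+1%:Z - k ->
    (forall i, r' (e i) = r (e i)) ->
    (forall j : 'I_l, (n < j)%N -> k - r j = k' - r' j) ->
  (h F n r' k' <= h F n r k)%N.
Proof.
move=> Ek' Er' Ez; have [p goodp <-] := h_std_position r k.
rewrite (hpz_cremona charF0 Ek' Er' Ez goodp).
exact/h_le/(@std_position_neq0 _)/std_position_rowinv.
Qed.

End Minimum.

(** * Cremona symmetry of the minimum *)

Theorem mainTheorem7 (F : closedFieldType) (charF0 : [pchar F] =i pred0)
  (n l : nat) (hn : (1 <= n)%N) (hl : (n.+1 < l)%N)
  (r : 'I_l -> int) (k : int) (hk : 0 <= k) :
  let s : int := \sum_(i < l | (i < n.+1)%N) r i in
  let k' : int := s - n.+1%:Z - k in
  let r' : 'I_l -> int :=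
    fun i => if (i < n.+1)%N then r i else s - n.+1%:Z + r i - 2 * k in
  h F n r k = h F n r' k'.
Proof.
move=> s k' r'; pose e := widen_ord (ltnW hl).
have sE : s = \sum_i r (e i).
  by rewrite /s (big_ord_narrow (ltnW hl)).
have Er' i : r' (e i) = r (e i) by rewrite /r' /= ltn_ord.
have Ez (j : 'I_l) : (n < j)%N -> k - r j = k' - r' j.
  by move=> lt_nj; rewrite /r' ltnS leqNgt lt_nj /= /k'; ring.
apply/eqP; rewrite eqn_leq; apply/andP; split.
  (* The data [(r', k')] reflect back to [(r, k)], so the same inequality serves in both
     directions. *)
  apply: (h_cremona_le charF0 (hl := hl)) => [|i|j lt_nj]; rewrite ?Er' ?Ez //.
  under eq_bigr do rewrite Er'.
  by rewrite -sE /k'; ring.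
by apply: (h_cremona_le charF0 (hl := hl)); rewrite -?sE.
Qed.
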